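(* Let $N\ge1$ and $D\ge1$ be integers and let $\mathcal R=\mathbb R[t]/(t^D)$. Let $A\in\mathcal R^{N\times N}$ be symmetric with distinct eigenvalues (meaning that its constant coefficient $A_0\in\mathbb R^{N\times N}$ has $N$ distinct eigenvalues), and let $Q,\Lambda\in\mathcal R^{N\times N}$ be its eigenvalue decomposition, i.e. $$Q^TAQ=\Lambda,\qquad Q^TQ=I,\qquad \Lambda=\operatorname{diag}(\lambda_1,\dots,\lambda_N)\text{ diagonal}.$$ Given $A$, $Q$, $\Lambda$ and adjoints $\bar Q,\bar\Lambda\in\mathcal R^{N\times N}$ of $Q$ and $\Lambda$, the pullback of the symmetric eigenvalue decomposition $A\mapsto(Q,\Lambda)$ computes the adjoint $\bar A\in\mathcal R^{N\times N}$ of $A$ by $$H_{ij}=(\lambda_j-\lambda_i)^{-1}\ \text{ if } i\neq j,\qquad H_{ij}=0\ \text{ else},$$ $$\bar A=Q\big(\bar\Lambda+H\circ(Q^T\bar Q)\big)Q^T ,$$ all operations being carried out in $\mathcal R$. That is, this $\bar A$ satisfies $$\operatorname{tr}(\bar A^T\mathrm dA)=\operatorname{tr}(\bar\Lambda^T\mathrm d\Lambda)+\operatorname{tr}(\bar Q^T\mathrm dQ)$$ for the differentials $\mathrm dA,\mathrm dQ,\mathrm d\Lambda$ of the eigenvalue decomposition.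
   Context: Matrices over $\mathcal R=\mathbb R[t]/(t^D)$ are identified with polynomials $\sum_{d=0}^{D-1}X_dt^d$ with real matrix coefficients, multiplied modulo $t^D$; the case $D=1$ is the ordinary real case. $\circ$ is the Hadamard (entrywise) product, $I$ the identity matrix. The pullback of a decomposition $A\mapsto(Q,\Lambda)$ is the map computing the adjoint $\bar A$ of the input from the adjoints $\bar Q,\bar\Lambda$ of the outputs (together with $A,Q,\Lambda$) such that $\operatorname{tr}(\bar A^T\mathrm dA)=\operatorname{tr}(\bar\Lambda^T\mathrm d\Lambda)+\operatorname{tr}(\bar Q^T\mathrm dQ)$. The differentials $\mathrm dA,\mathrm dQ,\mathrm d\Lambda$ (with $\mathrm dA$ symmetric, as $A$ is) are those obtained by differentiating the system $Q^TAQ-\Lambda=0$, $Q^TQ-I=0$, off-diagonal part of $\Lambda$ equal to $0$; that is, $\mathrm d\Lambda=\mathrm dQ^TAQ+Q^T\mathrm dA\,Q+Q^TA\,\mathrm dQ$, $\mathrm dQ^TQ+Q^T\mathrm dQ=0$, and $\mathrm d\Lambda$ diagonal.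
   Formalization: The adjoint Λ̄ is assumed diagonal, as the adjoint of a diagonal output; for arbitrary Λ̄ the identity fails, e.g. N=2, D=1, A=Λ=diag(0,1), Q=I, Q̄=0, Λ̄=E₁₂, dQ=E₁₂−E₂₁, dA=E₁₂+E₂₁, dΛ=0 gives 1 on the left and 0 on the right. *)

(* Defs.v *)
From HB Require Import structures.
From mathcomp Require Import all_boot all_order all_algebra.
From mathcomp Require Import reals.

Set Implicit Arguments.
Unset Strict Implicit.
Unset Printing Implicit Defensive.

Import Order.TTheory GRing.Theory Num.Theory.

Local Open Scope ring_scope.

(* The truncated polynomial ring R[t]/(t^D).  An element is stored as its       *)
(* representative of degree < D.  For D = 0 the library falls back to R[t]/(t), *)
(* so 0 < D must be assumed.                                                    *)
Notation tpoly R D := {poly %/ ('X^D : {poly R})}.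

Lemma mk_monic_Xn (R : nzRingType) (D : nat) :
  (0 < D)%N -> mk_monic ('X^D : {poly R}) = 'X^D.
Proof. by move=> D_gt0; rewrite /mk_monic size_polyXn ltnS D_gt0 monicXn. Qed.

Definition coef0_mx (R : realType) (D N : nat) (A : 'M[tpoly R D]_N) : 'M[R]_N :=
  map_mx (fun p : tpoly R D => (p : {poly R})`_0) A.

Definition distinct_eigenvalues (R : realType) (D N : nat)
    (A : 'M[tpoly R D]_N) : Prop :=
  exists s : seq R,
    [/\ uniq s, size s = N & {in s, forall a, eigenvalue (coef0_mx A) a}].

Definition hadamard (S : pzRingType) (m n : nat) (A B : 'M[S]_(m, n)) :
  'M[S]_(m, n) := map2_mx *%R A B.

Definition is_sym_eig_decomp (S : pzRingType) (N : nat) (A Q L : 'M[S]_N) : Prop :=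
  [/\ Q^T *m A *m Q = L, Q^T *m Q = 1%:M & is_diag_mx L].

Definition is_sym_eig_differential (S : pzRingType) (N : nat)
    (A Q dA dQ dL : 'M[S]_N) : Prop :=
  [/\ dA^T = dA,
      dL = dQ^T *m A *m Q + Q^T *m dA *m Q + Q^T *m A *m dQ,
      dQ^T *m Q + Q^T *m dQ = 0 &
      is_diag_mx dL].

(* The inverse is a genuine one as soon as L j j - L i i is a unit; otherwise   *)
(* the library's x^-1 is x.                                                     *)
Definition eig_H (S : unitRingType) (N : nat) (L : 'M[S]_N) : 'M[S]_N :=
  \matrix_(i, j) if i != j then (L j j - L i i)^-1 else 0.

(* Lb is the adjoint of the diagonal matrix L, hence is itself meant to be      *)
(* diagonal: since dL is diagonal, the off-diagonal entries of Lb do not enter  *)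
(* \tr (Lb^T *m dL), whereas they would enter \tr (Ab^T *m dA).                 *)
Definition sym_eig_pullback (S : unitRingType) (N : nat)
    (Q L Qb Lb : 'M[S]_N) : 'M[S]_N :=
  Q *m (Lb + hadamard (eig_H L) (Q^T *m Qb)) *m Q^T.

(* Main.v *)
Require Import Defs.
From HB Require Import structures.
From mathcomp Require Import all_boot all_order all_algebra.
From mathcomp Require Import reals.

Set Implicit Arguments.
Unset Strict Implicit.
Unset Printing Implicit Defensive.

Import Order.TTheory GRing.Theory Num.Theory.

Local Open Scope ring_scope.

(** In the eigenbasis put [C = Q^T dQ] and [P = Q^T dA Q].  Orthogonality makes
    [C] antisymmetric, and the differentiated equation becomes
    [dL = P + L C - C L].  Since [dL] is diagonal, [P i i = dL i i] and
    [P i j = (L j j - L i i) C i j] off the diagonal, so that [H] undoes the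
    factor [L j j - L i i] when [P] is paired with [Lb + H o (Q^T Qb)].  These
    differences are invertible because their constant coefficients are
    differences of distinct eigenvalues of [A_0]. *)

Section ConstantCoefficient.

Variables (R : realType) (D : nat).

Definition coef0_tpoly (p : tpoly R D) : R := (p : {poly R})`_0.

Fact coef0_tpoly_is_zmod_morphism : zmod_morphism coef0_tpoly.
Proof. by move=> p q; rewrite /coef0_tpoly /= coefB. Qed.

Fact coef0_tpoly_is_monoid_morphism : monoid_morphism coef0_tpoly.
Proof.
split=> [|p q]; rewrite /coef0_tpoly /=; first by rewrite coefC.
(* The exponent [D.-1.+1] is the one in the library's modulus: [D] if positive, else 1. The modulus
   is thus always a multiple of ['X], so reduction keeps the constant coefficient. *)
have mod0 (r : {poly R}) : (Pdiv.CommonRing.rmodp r 'X^(D.-1.+1))`_0 = r`_0.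
  rewrite [in RHS](Pdiv.RingMonic.rdivp_eq (monicXn R D.-1.+1) r).
  by rewrite coefD coefMXn add0r.
by rewrite -coef0M -[RHS]mod0 -qpoly.mk_monic_Xn.
Qed.

HB.instance Definition _ :=
  GRing.isZmodMorphism.Build (tpoly R D) R coef0_tpoly
    coef0_tpoly_is_zmod_morphism.
HB.instance Definition _ :=
  GRing.isMonoidMorphism.Build (tpoly R D) R coef0_tpoly
    coef0_tpoly_is_monoid_morphism.

(** Units of the quotient are the classes coprime to the modulus, and a power of ['X] is coprime to
    every polynomial not vanishing at 0. *)
Lemma tpoly_unit (p : tpoly R D) : coef0_tpoly p != 0 -> p \is a GRing.unit.
Proof.
suff unitP (q : {poly R}) : q`_0 != 0 -> coprimep (mk_monic 'X^D) q.
  exact: unitP.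
move=> q0; rewrite qpoly.mk_monic_Xn coprimep_sym coprimep_expr //.
by rewrite coprimepX /root horner_coef0.
Qed.

End ConstantCoefficient.

Lemma sym_eig_decomp_map (S T : comUnitRingType) (f : {rmorphism S -> T})
    (N : nat) (A Q L : 'M[S]_N) :
  is_sym_eig_decomp A Q L ->
  is_sym_eig_decomp (map_mx f A) (map_mx f Q) (map_mx f L).
Proof.
case=> AL QQ /is_diag_mxP Ldiag; split.
- by rewrite map_trmx -!map_mxM AL.
- by rewrite map_trmx -map_mxM QQ map_mx1.
- by apply/is_diag_mxP => i j ij; rewrite mxE Ldiag // rmorph0.
Qed.

(** If [v] is a row eigenvector of [A], then [v *m Q] is one of the diagonal matrix [L]; any nonzero
    coordinate of it singles out the diagonal entry [a]. *)
Lemma eigenvalue_sym_eig_decomp (F : fieldType) (N : nat) (A Q L : 'M[F]_N)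
    (a : F) :
  is_sym_eig_decomp A Q L -> eigenvalue A a -> exists i, a = L i i.
Proof.
case=> AL QQ /is_diag_mxP Ldiag /eigenvalueP [v vA v0].
have QQ' := mulmx1C QQ.
have wL : (v *m Q) *m L = a *: (v *m Q).
  by rewrite -AL !mulmxA -(mulmxA v) QQ' mulmx1 vA -scalemxAl.
have w0 : v *m Q != 0.
  apply: contraNneq v0 => w0.
  by rewrite -(mulmx1 v) -QQ' mulmxA w0 mul0mx.
have [i wi] := rV0Pn _ w0.
exists i; apply: (mulIf wi).
transitivity ((a *: (v *m Q)) 0 i); first by rewrite [RHS]mxE.
rewrite -wL mxE (bigD1 i) //= big1 ?addr0 => [|k ki]; first exact: mulrC.
by rewrite Ldiag ?mulr0.
Qed.

(** By counting: the [N] distinct values of [s] all occur among the [N] diagonal entries of [L],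
    which leaves no room for a repetition. *)
Lemma sym_eig_decomp_diag_inj (F : fieldType) (N : nat) (A Q L : 'M[F]_N)
    (s : seq F) :
  is_sym_eig_decomp A Q L -> uniq s -> size s = N ->
  {in s, forall a, eigenvalue A a} -> injective (fun i => L i i).
Proof.
move=> AQL us sN sA; apply/injectiveP; rewrite /injectiveb /dinjectiveb.
apply: (leq_size_uniq us) => [a /sA /(eigenvalue_sym_eig_decomp AQL) [i ->]|].
  exact: (image_f (fun i => L i i)).
by rewrite size_map -cardE card_ord sN.
Qed.

Lemma tpoly_eigenvalue_sub_unit (R : realType) (N D : nat)
    (A Q L : 'M[tpoly R D]_N) :
  distinct_eigenvalues A -> is_sym_eig_decomp A Q L ->
  forall i j, i != j -> L j j - L i i \is a GRing.unit.
Proof.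
move=> [s [us sN sA]] /(sym_eig_decomp_map (@coef0_tpoly R D)) AQL i j ij.
have inj := sym_eig_decomp_diag_inj AQL us sN sA.
apply: tpoly_unit; rewrite rmorphB subr_eq0.
apply: contraNneq ij => Lij; apply/eqP/inj.
by rewrite !mxE.
Qed.

(** Writes the trace pairing as an entrywise sum, so that the adjoint identity can be checked one
    entry at a time. *)
Lemma mxtrace_mul_tr (S : pzSemiRingType) (m n : nat) (X Y : 'M[S]_(m, n)) :
  \tr (X^T *m Y) = \sum_i \sum_j X i j * Y i j.
Proof.
rewrite exchange_big; apply: eq_bigr => j _; rewrite mxE.
by apply: eq_bigr => i _; rewrite mxE.
Qed.

Section Pullback.

Variables (S : comUnitRingType) (N : nat).
Variables (A Q L dA dQ dL : 'M[S]_N).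
Hypothesis decompAQL : is_sym_eig_decomp A Q L.
Hypothesis diff : is_sym_eig_differential A Q dA dQ dL.

Lemma sym_eig_differential_antisym : (Q^T *m dQ)^T = - (Q^T *m dQ).
Proof.
have [_ _ dQQ _] := diff.
by rewrite trmx_mul trmxK; apply/eqP; rewrite -addr_eq0 dQQ.
Qed.

Lemma sym_eig_differential_eigenbasis :
  dL = Q^T *m dA *m Q + L *m (Q^T *m dQ) - (Q^T *m dQ) *m L.
Proof.
have [AL QQ _] := decompAQL; have [_ -> _ _] := diff.
have QQ' := mulmx1C QQ.
have AQ : A *m Q = Q *m L by rewrite -AL !mulmxA QQ' mul1mx.
have QA : Q^T *m A = L *m Q^T by rewrite -AL -!mulmxA QQ' mulmx1.
have C := sym_eig_differential_antisym.
rewrite trmx_mul trmxK in C.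
(* With [C = Q^T dQ], the term [dQ^T A Q] becomes [dQ^T Q L = - C L], and [Q^T A dQ] becomes
   [L C]. *)
rewrite -(mulmxA dQ^T) AQ mulmxA C QA mulNmx !mulmxA.
by rewrite [RHS]addrC addrA.
Qed.

Lemma sym_eig_differential_entry i j :
  (Q^T *m dA *m Q) i j = dL i j + (L j j - L i i) * (Q^T *m dQ) i j.
Proof.
have [_ _ Ldiag] := decompAQL; have [d Ld] := diag_mxP _ Ldiag.
have Lii k : L k k = d 0 k by rewrite Ld mxE eqxx mulr1n.
rewrite sym_eig_differential_eigenbasis !Lii Ld mul_diag_mx mul_mx_diag.
move: (Q^T *m dA *m Q) (Q^T *m dQ) => P C; rewrite !mxE.
by rewrite mulrBl (mulrC (C i j)) -!addrA addKr subrr addr0.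
Qed.

(** Antisymmetry gives only [2 C i i = 0], hence the need to cancel 2. *)
Lemma sym_eig_differential_diag i : 2%:R \is a @GRing.unit S ->
  (Q^T *m dQ) i i = 0.
Proof.
move=> unit2; apply: (mulrI unit2); rewrite mulr0 mulr_natl mulr2n.
have /matrixP/(_ i i) := sym_eig_differential_antisym.
by rewrite mxE [RHS]mxE => {1}->; rewrite addNr.
Qed.

Lemma sym_eig_pullback_adjoint (Qb Lb : 'M[S]_N) :
  2%:R \is a @GRing.unit S ->
  (forall i j, i != j -> L j j - L i i \is a GRing.unit) ->
  is_diag_mx Lb ->
  \tr ((sym_eig_pullback Q L Qb Lb)^T *m dA)
    = \tr (Lb^T *m dL) + \tr (Qb^T *m dQ).
Proof.
move=> unit2 unitL /is_diag_mxP Lbdiag.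
have [_ QQ _] := decompAQL; have [_ _ _ /is_diag_mxP dLdiag] := diff.
rewrite /sym_eig_pullback; set M := Lb + _.
(* Cyclicity of the trace moves the outer factors [Q] and [Q^T] onto [dA]. *)
have -> : \tr ((Q *m M *m Q^T)^T *m dA) = \tr (M^T *m (Q^T *m dA *m Q)).
  by rewrite !trmx_mul trmxK -(mulmxA Q) mxtrace_mulC !mulmxA.
have -> : \tr (Qb^T *m dQ) = \tr ((Q^T *m Qb)^T *m (Q^T *m dQ)).
  by rewrite trmx_mul trmxK -!mulmxA (mulmxA Q) (mulmx1C QQ) mul1mx.
rewrite !mxtrace_mul_tr -big_split; apply: eq_bigr => i _.
rewrite -big_split; apply: eq_bigr => j _ /=.
rewrite sym_eig_differential_entry {}/M.
move: (sym_eig_differential_diag i unit2).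
move: (Q^T *m Qb) (Q^T *m dQ) => K C Cii; rewrite !mxE.
(* On the diagonal [C i i = 0] leaves [Lb i i * dL i i] on both sides. Off it [Lb] and [dL] vanish,
   and the entry of [H] cancels [L j j - L i i]. *)
have [<-|ij] := eqVneq i j.
  by rewrite Cii subrr !mulr0 mul0r !addr0.
rewrite Lbdiag // dLdiag // mul0r !add0r [_^-1 * _]mulrC -mulrA.
by rewrite mulKr ?unitL.
Qed.

End Pullback.

Theorem mainTheorem4 (R : realType) (N D : nat) (hN : (1 <= N)%N) (hD : (1 <= D)%N)
    (A Q L : 'M[tpoly R D]_N)
    (hA : A^T = A) (hdist : distinct_eigenvalues A)
    (hdec : is_sym_eig_decomp A Q L)
    (Qb Lb : 'M[tpoly R D]_N) (hLb : is_diag_mx Lb)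
    (dA dQ dL : 'M[tpoly R D]_N)
    (hdiff : is_sym_eig_differential A Q dA dQ dL) :
  \tr ((sym_eig_pullback Q L Qb Lb)^T *m dA) = \tr (Lb^T *m dL) + \tr (Qb^T *m dQ).
Proof.
apply: (sym_eig_pullback_adjoint hdec hdiff) => //.
  (* The constant coefficient of 2 is the real number 2, which is nonzero. *)
  by apply: tpoly_unit; rewrite rmorph_nat pnatr_eq0.
exact: tpoly_eigenvalue_sub_unit hdist hdec.
Qed.
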